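(* The Euler characteristic $\chi(x)$ of a Schröder path $x$ in the Schröder lattice $\mathcal{S}_n$ equals the number of $0$-tunnels of $x$.
   Context: A Schröder path of length $2n$ is a lattice path from $(0,0)$ to $(2n,0)$, never going below the $x$-axis, with steps $U=(1,1)$, $D=(1,-1)$ and double horizontal steps $(2,0)$. The Schröder lattice $\mathcal{S}_n$ is the set of all Schröder paths of length $2n$, ordered by $x\le y$ iff $x$ lies weakly below $y$. It is a finite distributive lattice whose minimum $\widehat0$ is the path consisting of $n$ double horizontal steps. A join-irreducible element is an $x\ne\widehat0$ such that $x=u\vee v$ implies $x=u$ or $x=v$. A $0$-tunnel of a Schröder path $x$ is a segment of the $x$-axis, not reduced to a point, meeting $x$ only at its two endpoints; equivalently, $0$-tunnels correspond to factorizations $x=\alpha\,U\,\gamma\,D\,\beta$ where $\alpha,\gamma,\beta$ are (possibly empty) Schröder paths. A valuation on a finite distributive lattice $L$ is a map $\nu:L\to\mathbb{R}$ with $\nu(\widehat0)=0$ and $\nu(x\vee y)+\nu(x\wedge y)=\nu(x)+\nu(y)$ for all $x,y$. It is uniquely determined by its values on join-irreducibles, which can be assigned arbitrarily. The Euler characteristic $\chi$ of $L$ is the unique valuation with $\chi(x)=1$ for every join-irreducible $x$. *)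

(* Defs.v *)
From HB Require Import structures.
From mathcomp Require Import all_boot all_order all_algebra.
From mathcomp Require Import boolp reals.
From mathcomp Require Import zify.

Set Implicit Arguments.
Unset Strict Implicit.
Unset Printing Implicit Defensive.

Import Order.TTheory GRing.Theory Num.Theory.
Local Open Scope ring_scope.

Section Valuations.
Context {d : Order.disp_t} {L : finTBDistrLatticeType d}.

Definition join_irreducible (x : L) : Prop :=
  x <> \bot%O /\ forall u v : L, x = (u `|` v)%O -> x = u \/ x = v.

Definition valuation (R : realType) (nu : L -> R) : Prop :=
  nu \bot%O = 0 /\
  forall x y : L, nu (x `|` y)%O + nu (x `&` y)%O = nu x + nu y.

Lemma join_irreducible_leU (j x y : L) : join_irreducible j ->
  (j <= x `|` y)%O = (j <= x)%O || (j <= y)%O.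
Proof.
move=> [_ jirr]; apply/idP/orP => [jxy|[]]; last 2 first.
- by move=> jx; apply: le_trans jx (leUl _ _).
- by move=> jy; apply: le_trans jy (leUr _ _).
have : j = ((j `&` x) `|` (j `&` y))%O by rewrite -meetUr; apply/esym/meet_idPl.
by case/jirr => /esym/meet_idPl; [left|right].
Qed.

Lemma valuation_ext (R : realType) (nu1 nu2 : L -> R) :
  valuation nu1 -> valuation nu2 ->
  (forall j, join_irreducible j -> nu1 j = nu2 j) -> nu1 =1 nu2.
Proof.
move=> [n10 n1U] [n20 n2U] eqJ x.
have [m] := ubnP #|[set y | (y < x)%O]|; elim: m x => // m IHm x xm.
have IH y : (y < x)%O -> nu1 y = nu2 y.
  move=> yx; apply: IHm; rewrite -ltnS; apply: leq_trans xm.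
  rewrite ltnS; apply: proper_card; apply/properP; split.
    by apply/subsetP => z; rewrite !inE => /lt_trans; apply.
  by exists y; rewrite !inE ?ltxx.
have [->|x0] := eqVneq x \bot%O; first by rewrite n10 n20.
have [|/not_andP[/(_ (elimN eqP x0))//|]] := pselect (join_irreducible x).
  exact: eqJ.
move=> /existsNP[u /existsNP[v /not_implyP[xuv /not_orP[/eqP xu /eqP xv]]]].
have ux : (u < x)%O by rewrite lt_neqAle eq_sym xu xuv leUl.
have vx : (v < x)%O by rewrite lt_neqAle eq_sym xv xuv leUr.
have uvx : (u `&` v < x)%O by apply: le_lt_trans ux; exact: leIl.
have := n1U u v; have := n2U u v.
rewrite -xuv (IH u)// (IH v)// (IH _ uvx) => <-.
exact: addIr.
Qed.

Lemma valuation_exists (R : realType) (f : L -> R) :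
  exists nu : L -> R,
    valuation nu /\ forall j, join_irreducible j -> nu j = f j.
Proof.
have [J JE] : {J : pred L & forall j, reflect (join_irreducible j) (J j)}.
  by exists (fun j => `[< join_irreducible j >]) => j; exact: asboolP.
pose below j := [set y : L | (y < j)%O].
suff [w wE] : exists w : L -> R, forall j, J j ->
    \sum_(i | J i && (i <= j)%O) w i = f j.
  exists (fun x => \sum_(i | J i && (i <= x)%O) w i); split; last first.
    by move=> j /JE; exact: wE.
  split=> [|x y].
    rewrite big_pred0// => i; apply/negP => /andP[/JE iJ].
    by case: iJ => i0 _; rewrite lex0 => /eqP.
  rewrite !big_mkcondr -!big_split; apply: eq_bigr => i Ji.
  have iJ := JE i Ji.
  rewrite /= join_irreducible_leU// lexI.
  by case: (i <= x)%O; case: (i <= y)%O => //=; rewrite ?addr0 ?add0r.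
suff [w wE] : exists w : L -> R, forall j, J j -> (#|below j| < #|L|.+1)%N ->
    \sum_(i | J i && (i <= j)%O) w i = f j.
  by exists w => j Jj; apply: wE => //; rewrite ltnS max_card.
elim: #|L|.+1 => [|m [w wE]]; first by exists (fun=> 0).
exists (fun j => if (#|below j| < m)%N then w j
                 else f j - \sum_(i | J i && (i < j)%O) w i) => j Jj.
have lower i : (i < j)%O -> (#|below i| < #|below j|)%N.
  move=> ij; apply: proper_card; apply/properP; split.
    by apply/subsetP => z; rewrite !inE => /lt_trans; apply.
  by exists i; rewrite !inE ?ltxx.
have [jm _|mj jm] := ltnP #|below j| m.
  rewrite -wE//; apply: eq_bigr => i /andP[_].
  rewrite le_eqVlt => /orP[/eqP->|/lower ij]; first by rewrite jm.
  by rewrite (ltn_trans ij).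
rewrite (bigD1 j) ?Jj ?lexx//= ltnNge mj/=.
suff -> : \sum_(i | J i && (i <= j)%O && (i != j))
    (if (#|below i| < m)%N then w i
     else f i - \sum_(k | J k && (k < i)%O) w k) =
    \sum_(i | J i && (i < j)%O) w i by rewrite subrK.
apply: eq_big => [i|i /andP[/andP[_ ij] nij]].
  by rewrite -andbA; congr (_ && _); rewrite lt_neqAle andbC.
rewrite ifT//; apply: leq_trans (lower _ _) _; last by rewrite -ltnS.
by rewrite lt_neqAle nij ij.
Qed.

Definition euler_characteristic (R : realType) : L -> R :=
  sval (cid (valuation_exists (fun=> 1 : R))).

Lemma euler_characteristicP (R : realType) :
  valuation (@euler_characteristic R) /\
  forall j, join_irreducible j -> euler_characteristic R j = 1.
Proof. exact: svalP (cid (valuation_exists (fun=> 1 : R))). Qed.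

Lemma euler_characteristic_unique (R : realType) (nu : L -> R) :
  valuation nu -> (forall j, join_irreducible j -> nu j = 1) ->
  nu =1 euler_characteristic R.
Proof.
move=> nuV nu1; have [chiV chi1] := euler_characteristicP R.
by apply: valuation_ext => // j jJ; rewrite nu1// chi1.
Qed.

End Valuations.

(* [Horiz] is the double horizontal step (2, 0). *)
Inductive step := Up | Down | Horiz.

Definition ord_of_step (s : step) : 'I_3 :=
  match s with Up => inord 0 | Down => inord 1 | Horiz => inord 2 end.
Definition step_of_ord (i : 'I_3) : step :=
  match val i with 0%N => Up | 1%N => Down | _ => Horiz end.
Lemma ord_of_stepK : cancel ord_of_step step_of_ord.
Proof. by case; rewrite /step_of_ord /= inordK. Qed.

HB.instance Definition _ := Finite.copy step (can_type ord_of_stepK).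

Definition step_width (s : step) : nat := if s is Horiz then 2 else 1.
Definition step_rise (s : step) : int :=
  match s with Up => 1 | Down => -1 | Horiz => 0 end.

Definition width (p : seq step) : nat := (\sum_(s <- p) step_width s)%N.

(* The ordinate, at abscissa [k <= width p], of the path [p] started at the
   origin.  The only integer abscissae lying strictly inside a step are the
   midpoints of horizontal steps, where the ordinate is that of the left end
   of the step. *)
Fixpoint height (p : seq step) (k : nat) : int :=
  if p is s :: q then
    if (k < step_width s)%N then 0
    else step_rise s + height q (k - step_width s)
  else 0.

Definition is_schroder (p : seq step) : bool :=
  (height p (width p) == 0) &&
  [forall k : 'I_(width p).+1, 0 <= height p k].

(* Every step has width at least 1, so a path of length [2n] has at most [2n]
   steps and the bound on the number of steps is no restriction. *)
Record schroder (n : nat) := Schroder {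
  schroder_path :> n.*2.-bseq step;
  schroderP : (width schroder_path == n.*2) && is_schroder schroder_path }.

HB.instance Definition _ n := [isSub for @schroder_path n].
HB.instance Definition _ n := [Finite of schroder n by <:].

(* Paths are affine between consecutive integer abscissae, so comparing
   ordinates at integer abscissae is enough. *)
Definition schroder_le n (x y : schroder n) : bool :=
  [forall k : 'I_n.*2.+1, height x k <= height y k].

Lemma size_le_width p : (size p <= width p)%N.
Proof.
elim: p => [|s p IHp]; first by rewrite /width big_nil.
by rewrite /width big_cons -/(width p) /=; case: s => /=; lia.
Qed.

Lemma width_cons s p : width (s :: p) = (step_width s + width p)%N.
Proof. by rewrite /width big_cons. Qed.

Lemma width_nil : width [::] = 0%N.
Proof. by rewrite /width big_nil. Qed.

Lemma height0 p : height p 0 = 0.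
Proof. by case: p => // -[]. Qed.

(* The integer functions that are ordinate functions of lattice paths with
   steps in [step] starting at an even point: away from vertices (points with
   odd coordinate sum) the function must be constant up to the next one. *)
Definition path_like (f : nat -> int) (k : nat) : Prop :=
  if odd (k + `|f k|) then f k.+1 = f k else `|f k.+1 - f k| <= 1.

Lemma height_path_like p (k : nat) : (k < width p)%N -> path_like (height p) k.
Proof.
rewrite /path_like; elim: p k => [|s p IHp] k; first by rewrite width_nil.
rewrite width_cons; case: s => /=.
- case: k => [_|k]; first by rewrite height0.
  by rewrite add1n !ltnS ?ltn0 !subSS !subn0 => /IHp; do 2![case: ifP]; lia.
- case: k => [_|k]; first by rewrite height0.
  by rewrite add1n !ltnS ?ltn0 !subSS !subn0 => /IHp; do 2![case: ifP]; lia.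
- case: k => [|[|k]] //=; first by rewrite height0.
  by rewrite add2n !ltnS ?ltn0 !subSS !subn0 => /IHp; do 2![case: ifP]; lia.
Qed.

Lemma height_inj p q : width p = width q ->
  (forall k, (k <= width p)%N -> height p k = height q k) -> p = q.
Proof.
elim: p q => [|s p IHp] [|t q]; rewrite ?width_cons ?width_nil //.
- by case: t.
- by case: s.
move=> wE hE.
have st : s = t.
  have := hE 1%N; rewrite /= addn_gt0.
  have -> : (0 < step_width s)%N by case: s {wE hE}.
  by case: s t {wE hE} => [] [] //= /(_ isT); rewrite ?height0.
subst t; congr (_ :: _); apply: IHp => [|k kp]; first by lia.
have := hE (step_width s + k)%N; rewrite leq_add2l /= => /(_ kp).
by rewrite ltnNge leq_addr /= addKn => /addrI.
Qed.

(* The path over [k, k + m] with ordinates [f k, ..., f (k + m)]. *)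
Fixpoint path_of (f : nat -> int) (m k : nat) : seq step :=
  if m is m'.+1 then
    if f k.+1 == f k + 1 then Up :: path_of f m' k.+1
    else if f k.+1 == f k - 1 then Down :: path_of f m' k.+1
    else Horiz :: (if m' is m''.+1 then path_of f m'' k.+2 else [::])
  else [::].

Lemma path_ofP (f : nat -> int) m k :
  (forall i, (k <= i < k + m)%N -> path_like f i) ->
  ~~ odd (k + `|f k|) -> ~~ odd (k + m + `|f (k + m)%N|) ->
  width (path_of f m k) = m /\
  forall i, (i <= m)%N -> height (path_of f m k) i = f (k + i)%N - f k.
Proof.
have [M] := ubnP m; elim: M m k => // M IHM [|m] k /= mM fP ek em.
  by split=> [|[|i]//]; rewrite ?width_nil // addn0 subrr.
have := fP k; rewrite /path_like (negbTE ek) => fk.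
have {}fk : `|f k.+1 - f k| <= 1 by apply: fk; lia.
have [fU|fU] := eqVneq (f k.+1) (f k + 1).
  have [||||w h] := IHM m k.+1; first by lia.
  - by move=> i ki; apply: fP; lia.
  - by lia.
  - by rewrite addSnnS.
  split=> [|[|i] im]; first by rewrite width_cons w.
    by rewrite addn0 subrr.
  by rewrite /= subSS subn0 h // fU addSnnS; lia.
have [fD|fD] := eqVneq (f k.+1) (f k - 1).
  have [||||w h] := IHM m k.+1; first by lia.
  - by move=> i ki; apply: fP; lia.
  - by lia.
  - by rewrite addSnnS.
  split=> [|[|i] im]; first by rewrite width_cons w.
    by rewrite addn0 subrr.
  by rewrite /= subSS subn0 h // fD addSnnS; lia.
have fH : f k.+1 = f k by lia.
case: m mM fP em => [|m] mM fP em; first by rewrite addn1 in em; lia.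
have fH2 : f k.+2 = f k.
  by have := fP k.+1; rewrite /path_like ifT ?fH; [apply|]; lia.
have [||||w h] := IHM m k.+2; first by lia.
- by move=> i ki; apply: fP; lia.
- by lia.
- by rewrite !addSnnS.
split=> [|[|[|i]] im]; first by rewrite width_cons w.
- by rewrite addn0 subrr.
- by rewrite addn1 fH subrr.
by rewrite /= !subSS subn0 h // fH2 !addSnnS add0r.
Qed.

Section SchroderLattice.
Variable n : nat.
Implicit Types x y z : schroder n.

Lemma width_schroder x : width x = n.*2.
Proof. by case/andP: (schroderP x) => /eqP. Qed.

Lemma height_schroder_ge0 x k : (k <= n.*2)%N -> 0 <= height x k.
Proof.
move=> kn; case/andP: (schroderP x) => _ /andP[_ /forallP x0].
have kx : (k < (width x).+1)%N by rewrite width_schroder.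
exact: x0 (Ordinal kx).
Qed.

Lemma height_schroder_end x : height x n.*2 = 0.
Proof.
by case/andP: (schroderP x) => _ /andP[/eqP + _]; rewrite width_schroder.
Qed.

Lemma schroder_eqP x y :
  (forall k, (k <= n.*2)%N -> height x k = height y k) -> x = y.
Proof.
move=> xy; apply: val_inj; apply: val_inj => /=.
by apply: height_inj; rewrite !width_schroder.
Qed.

Lemma schroder_ex (f : nat -> int) :
  f 0%N = 0 -> f n.*2 = 0 -> (forall k, (k <= n.*2)%N -> 0 <= f k) ->
  (forall k, (k < n.*2)%N -> path_like f k) ->
  exists x, forall k, (k <= n.*2)%N -> height x k = f k.
Proof.
move=> f0 fn fge fP.
have [||| w h] := @path_ofP f n.*2 0 => //; rewrite ?add0n ?f0 ?fn //.
  by rewrite absz0 addn0 odd_double.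
have {}h k : (k <= n.*2)%N -> height (path_of f n.*2 0) k = f k.
  by move=> kn; rewrite h // f0 subr0.
have sz : (size (path_of f n.*2 0) <= n.*2)%N by rewrite -{2}w size_le_width.
have pP : (width (Bseq sz) == n.*2) && is_schroder (Bseq sz).
  rewrite /is_schroder /= w eqxx h // fn eqxx /=; apply/forallP => k.
  by rewrite h ?fge // -ltnS.
by exists (Schroder pP).
Qed.

Lemma schroder_join_ex x y : exists z, forall k, (k <= n.*2)%N ->
  height z k = Num.max (height x k) (height y k).
Proof.
apply: schroder_ex; rewrite ?height0 ?height_schroder_end ?maxxx //.
  by move=> k kn; rewrite le_max height_schroder_ge0.
move=> k kn; have xP := @height_path_like x k; have yP := @height_path_like y k.
rewrite !width_schroder in xP yP; move: (xP kn) (yP kn); rewrite /path_like.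
by do 3![case: ifP]; lia.
Qed.

Lemma schroder_meet_ex x y : exists z, forall k, (k <= n.*2)%N ->
  height z k = Num.min (height x k) (height y k).
Proof.
apply: schroder_ex; rewrite ?height0 ?height_schroder_end ?minxx //.
  by move=> k kn; rewrite le_min !height_schroder_ge0.
move=> k kn; have xP := @height_path_like x k; have yP := @height_path_like y k.
rewrite !width_schroder in xP yP; move: (xP kn) (yP kn); rewrite /path_like.
by do 3![case: ifP]; lia.
Qed.

Lemma schroder_bot_ex : exists z, z = nseq n Horiz :> seq step.
Proof.
have sz : (size (nseq n Horiz) <= n.*2)%N by rewrite size_nseq; lia.
have w m : width (nseq m Horiz) = m.*2.
  by elim: m => [|m IHm]; rewrite ?width_nil //= width_cons IHm.
have h m k : height (nseq m Horiz) k = 0.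
  by elim: m k => [|m IHm] k //=; rewrite IHm addr0 if_same.
have pP : (width (Bseq sz) == n.*2) && is_schroder (Bseq sz).
  rewrite /= w eqxx /is_schroder h eqxx /=; apply/forallP => k.
  by rewrite h.
by exists (Schroder pP).
Qed.

Definition schroder_bot : schroder n := sval (cid schroder_bot_ex).
Definition schroder_join x y : schroder n := sval (cid (schroder_join_ex x y)).
Definition schroder_meet x y : schroder n := sval (cid (schroder_meet_ex x y)).

Lemma schroder_botE : schroder_bot = nseq n Horiz :> seq step.
Proof. exact: svalP (cid schroder_bot_ex). Qed.

Lemma height_join x y k : (k <= n.*2)%N ->
  height (schroder_join x y) k = Num.max (height x k) (height y k).
Proof. exact: (svalP (cid (schroder_join_ex x y))). Qed.

Lemma height_meet x y k : (k <= n.*2)%N ->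
  height (schroder_meet x y) k = Num.min (height x k) (height y k).
Proof. exact: (svalP (cid (schroder_meet_ex x y))). Qed.

Lemma schroder_leP x y :
  reflect (forall k, (k <= n.*2)%N -> height x k <= height y k)
          (schroder_le x y).
Proof.
apply: (iffP forallP) => [xy k kn|xy k]; last by apply: xy; rewrite -ltnS.
have kn1 : (k < n.*2.+1)%N by [].
exact: xy (Ordinal kn1).
Qed.

Lemma schroder_le_def x y : schroder_le x y = (schroder_meet x y == x).
Proof.
apply/schroder_leP/eqP => [xy|<- k kn]; last first.
  by rewrite height_meet // ge_min lexx orbT.
by apply: schroder_eqP => k kn; rewrite height_meet //; apply/min_idPl/xy.
Qed.

End SchroderLattice.

Ltac schroder_ext :=
  repeat (let x := fresh in intro x); apply: schroder_eqP => ? ?;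
  rewrite ?(height_join, height_meet) //; lia.

Fact schroder_display : Order.disp_t. Proof. exact: Order.Disp tt tt. Qed.

Section SchroderLatticeInstances.
Variable n : nat.

Lemma schroder_lt_def (x y : schroder n) :
  (y != x) && schroder_le x y = (y != x) && schroder_le x y.
Proof. by []. Qed.
Lemma schroder_meetC : commutative (@schroder_meet n).
Proof. schroder_ext. Qed.
Lemma schroder_joinC : commutative (@schroder_join n).
Proof. schroder_ext. Qed.
Lemma schroder_meetA : associative (@schroder_meet n).
Proof. schroder_ext. Qed.
Lemma schroder_joinA : associative (@schroder_join n).
Proof. schroder_ext. Qed.
Lemma schroder_joinKI (y x : schroder n) :
  schroder_meet x (schroder_join x y) = x.
Proof. schroder_ext. Qed.
Lemma schroder_meetKU (y x : schroder n) :
  schroder_join x (schroder_meet x y) = x.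
Proof. schroder_ext. Qed.
Lemma schroder_meetUl :
  left_distributive (@schroder_meet n) (@schroder_join n).
Proof. schroder_ext. Qed.
Lemma schroder_meetxx : idempotent_op (@schroder_meet n).
Proof. schroder_ext. Qed.

HB.instance Definition _ :=
  Order.isMeetJoinDistrLattice.Build schroder_display (schroder n)
    (@schroder_le_def n) schroder_lt_def schroder_meetC schroder_joinC
    schroder_meetA schroder_joinA schroder_joinKI schroder_meetKU
    schroder_meetUl schroder_meetxx.

Lemma schroder_bot_le (x : schroder n) : (schroder_bot n <= x)%O.
Proof.
apply/schroder_leP => k kn; rewrite schroder_botE.
suff -> : height (nseq n Horiz) k = 0 by apply: height_schroder_ge0.
by elim: (X in nseq X) k {kn} => [|m IHm] k //=; rewrite IHm addr0 if_same.
Qed.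

HB.instance Definition _ :=
  Order.hasBottom.Build schroder_display (schroder n) schroder_bot_le.

Lemma schroder_le_top (x : schroder n) : (x <= \join_(y : schroder n) y)%O.
Proof. exact: joins_sup. Qed.

HB.instance Definition _ :=
  Order.hasTop.Build schroder_display (schroder n) schroder_le_top.

End SchroderLatticeInstances.

(* 0-tunnels of [x] correspond to factorizations [x = alpha U gamma D beta]
   into Schroeder paths, the tunnel being the part of the axis below the factor
   [U gamma D].  The factors have no more steps than [x], whence the type. *)
Record factors (n : nat) := Factors {
  alpha : n.*2.-bseq step; gamma : n.*2.-bseq step; beta : n.*2.-bseq step }.

Definition prod_of_factors n (t : factors n) := (alpha t, gamma t, beta t).
Definition factors_of_prod n
    (t : n.*2.-bseq step * n.*2.-bseq step * n.*2.-bseq step) :=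
  Factors t.1.1 t.1.2 t.2.
Lemma prod_of_factorsK n : cancel (@prod_of_factors n) (@factors_of_prod n).
Proof. by case. Qed.

HB.instance Definition _ n :=
  Finite.copy (factors n) (can_type (@prod_of_factorsK n)).

Definition zero_tunnels n (x : schroder n) : {set factors n} :=
  [set t : factors n |
    [&& is_schroder (alpha t), is_schroder (gamma t), is_schroder (beta t)
      & (x : seq step) == alpha t ++ Up :: gamma t ++ Down :: beta t]].

(* Main.v *)
Require Import Defs.
From mathcomp Require Import all_boot all_order all_algebra.
From mathcomp Require Import reals.
From mathcomp Require Import zify.

(** The [0]-tunnels of [x] are in bijection with the abscissae [k] at which
    [x] leaves the axis, i.e. has ordinate zero at [k] and positive ordinate at
    [k + 1].  Joins and meets of paths take unions and intersections of the
    sets of abscissae with positive ordinate, and these sets are constrained: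
    for even [k], a path positive at [k] is positive at [k + 1], and for odd
    [k] the converse holds.  Under these constraints the indicator of leaving
    the axis at [k] is modular, hence the number of [0]-tunnels is a valuation.
    A path with two [0]-tunnels is the join of its proper parts before and
    after the start of the second one, so a join-irreducible path has exactly
    one. *)

Set Implicit Arguments.
Unset Strict Implicit.
Unset Printing Implicit Defensive.

Import Order.TTheory GRing.Theory Num.Theory.
Local Open Scope ring_scope.

(** * Concatenation and factorization of step sequences *)

Lemma width_cat p q : width (p ++ q) = (width p + width q)%N.
Proof. by rewrite /width big_cat. Qed.

Lemma height_cat_left p q k : (k <= width p)%N -> height (p ++ q) k = height p k.
Proof.
elim: p k => [|s p IHp] k; first by rewrite width_nil leqn0 => /eqP->; rewrite height0.
rewrite width_cons /= => kp; case: ltnP => // sk.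
by rewrite IHp //; lia.
Qed.

Lemma height_cat_right p q k :
  height (p ++ q) (width p + k) = height p (width p) + height q k.
Proof.
elim: p => [|s p IHp]; first by rewrite width_nil add0n add0r.
rewrite width_cons /= -addnA ltnNge leq_addr /= ltnNge leq_addr /= !addKn.
by rewrite IHp addrA.
Qed.

Lemma height_step_cons s p k :
  height (s :: p) (step_width s + k) = step_rise s + height p k.
Proof. by rewrite /= ltnNge leq_addr /= addKn. Qed.

Lemma is_schroderP p :
  reflect (height p (width p) = 0 /\
           forall k, (k <= width p)%N -> 0 <= height p k) (is_schroder p).
Proof.
apply: (iffP andP) => [[/eqP-> /forallP pge]|[-> pge]]; split=> //.
  by move=> k; rewrite -ltnS => kp; exact: pge (Ordinal kp).
by apply/forallP => k; apply: pge; rewrite -ltnS.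
Qed.

(** A horizontal step has equal ordinates at its left end, midpoint and right end, so a change of
    ordinate after [k] forces an [Up] or [Down] starting exactly at [k]. *)
Lemma split_path p k : (k < width p)%N -> height p k.+1 <> height p k ->
  exists a s b, [/\ p = a ++ s :: b, width a = k, step_width s = 1%N
                  & step_rise s = height p k.+1 - height p k].
Proof.
elim: p k => [|s p IHp] k; first by rewrite width_nil.
have [ks _ sk|sk] := ltnP k (step_width s).
  exists [::], s, p; rewrite width_nil.
  case: s ks sk => [] /=; case: k => [|[|k]] //=; rewrite ?height0 //.
rewrite -(subnKC sk) width_cons ltn_add2l -addnS !height_step_cons.
move=> kp neq; have [|a [t [b [-> wa tw tr]]]] := IHp _ kp.
  by move=> E; apply: neq; rewrite E.
exists (s :: a), t, b; split=> //; first by rewrite width_cons wa.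
by rewrite tr; lia.
Qed.

Lemma cat_width_inj a b a' b' : a ++ b = a' ++ b' -> width a = width a' ->
  a = a' /\ b = b'.
Proof.
elim: a a' => [|s a IHa] [|s' a'] //=; rewrite ?width_cons ?width_nil //.
- by case: s'.
- by case: s.
by case=> <- /IHa IH /addnI /IH[-> ->].
Qed.

(** If [g] were shorter than [g'], the [Down] after it would lie within [g'] and take it to ordinate
    -1. Used in both directions, this makes the matching [Down] of a tunnel unique. *)
Lemma schroder_down_width_le g b g' b' : is_schroder g -> is_schroder g' ->
  g ++ Down :: b = g' ++ Down :: b' -> (width g' <= width g)%N.
Proof.
move=> /is_schroderP[g0 _] /is_schroderP[_ g'ge] E.
rewrite leqNgt; apply/negP => gg'.
have := g'ge (width g + 1)%N; rewrite addn1 => /(_ gg').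
rewrite -(height_cat_left (Down :: b') gg') -E -addn1 height_cat_right g0.
by rewrite (height_step_cons Down b 0) height0.
Qed.

(** * Bijection between 0-tunnels and departures from the axis *)

Section Rises.
Variable n : nat.
Implicit Types x y : schroder n.

Definition rises_at x k := (height x k == 0) && (height x k.+1 == 1).

Definition zero_rises x : {set 'I_n.*2.+1} :=
  [set k : 'I_n.*2.+1 | (k < n.*2)%N && rises_at x k].

Lemma schroder_path_like x k : (k < n.*2)%N -> path_like (height x) k.
Proof. by move=> kn; apply: height_path_like; rewrite width_schroder. Qed.

Lemma zero_tunnels_inj x (t t' : factors n) :
  t \in zero_tunnels x -> t' \in zero_tunnels x ->
  width (alpha t) = width (alpha t') -> t = t'.
Proof.
case: t t' => [a g b] [a' g' b']; rewrite !inE /=.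
move=> /and4P[_ gS _ /eqP xE] /and4P[_ g'S _ /eqP]; rewrite xE => E wE.
have [aE [gE]] := cat_width_inj E wE.
have gw : width g = width g'.
  apply/eqP; rewrite eqn_leq (schroder_down_width_le g'S gS (esym gE)).
  exact: schroder_down_width_le gS g'S gE.
have [g_g' [bE]] := cat_width_inj gE gw.
by congr Factors; apply: val_inj.
Qed.

Lemma tunnel_rises x (t : factors n) : t \in zero_tunnels x ->
  (width (alpha t) < n.*2)%N && rises_at x (width (alpha t)).
Proof.
rewrite inE => /and4P[/is_schroderP[a0 _] _ _ /eqP xE].
have := width_schroder x; rewrite /rises_at xE width_cat width_cons /= => wx.
rewrite height_cat_left // a0 -addn1 height_cat_right a0.
by rewrite (height_step_cons Up _ 0) height0 !eqxx andbT; lia.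
Qed.

Lemma rise_tunnel x k : (k < n.*2)%N -> rises_at x k ->
  exists2 t, t \in zero_tunnels x & width (alpha t) = k.
Proof.
move=> kn /andP[/eqP hk /eqP hk1].
have [||a [s [c [xE wa _ sr]]]] := @split_path x k.
- by rewrite width_schroder.
- by rewrite hk hk1.
have {sr} sU : s = Up by move: sr; rewrite hk hk1; case: s {xE}.
rewrite {s}sU in xE.
have ha i : (i <= width a)%N -> height a i = height x i.
  by move=> ia; rewrite xE height_cat_left.
have hc i : height c i = height x (k.+1 + i)%N - 1.
  rewrite xE addSnnS -wa height_cat_right (height_step_cons Up c i).
  by rewrite ha // wa hk /=; lia.
have wx := width_schroder x; rewrite xE width_cat width_cons wa /= in wx.
(* The matching [Down] ends at the first return [k + 2 + j] to the axis. *)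
have exj : exists j, (j < width c)%N && (height c j.+1 == -1).
  have := hc (width c); rewrite addSnnS -[_.+1]add1n wx height_schroder_end.
  case: (width c) => [|m] hm; last by exists m; rewrite leqnn hm.
  by rewrite height0 in hm.
case: (ex_minnP exj) => j /andP[jc /eqP hj] jmin.
(* Since [x] is nonnegative, [c] stays at or above -1, and minimality of [j] excludes -1 itself. *)
have cge i : (i <= j)%N -> 0 <= height c i.
  case: i => [|i] ij; first by rewrite height0.
  have := @height_schroder_ge0 n x (k.+1 + i.+1)%N.
  have := jmin i; have := hc i.+1; case: eqP => /=; lia.
have [||g [s [b [cE wg _ sr]]]] := @split_path c j => //.
  by have := cge j; lia.
(* A single step leads from this nonnegative ordinate to -1, and no step descends by more than 1. *)
have hjj : height c j = 0.
  have := cge j; rewrite hj in sr.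
  by case: s sr {cE} => /=; lia.
have {sr} sD : s = Down by move: sr; rewrite hj hjj; case: s {cE}.
rewrite {s}sD in cE.
have xE' : x = a ++ Up :: g ++ Down :: b :> seq step by rewrite xE cE.
have szx := size_bseq x.
rewrite xE' size_cat /= size_cat /= in szx.
have sza : (size a <= n.*2)%N by lia.
have szg : (size g <= n.*2)%N by lia.
have szb : (size b <= n.*2)%N by lia.
exists (Factors (Bseq sza) (Bseq szg) (Bseq szb)); last by [].
have hg i : (i <= width g)%N -> height g i = height c i.
  by move=> ig; rewrite cE height_cat_left.
have hb i : height b i = height x (k.+1 + j.+1 + i)%N.
  have := hc (j.+1 + i)%N; rewrite addnA => /eqP; rewrite eq_sym subr_eq => /eqP->.
  rewrite cE addSnnS -wg height_cat_right (height_step_cons Down b i).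
  by rewrite hg // wg hjj /=; lia.
have wc : width c = (j + (1 + width b))%N by rewrite cE width_cat width_cons wg.
rewrite inE /= xE' eqxx andbT; apply/and3P; split; apply/is_schroderP.
- split=> [|i ia]; first by rewrite ha // wa.
  by rewrite ha // height_schroder_ge0 //; lia.
- split=> [|i ig]; first by rewrite hg // wg.
  by rewrite hg // cge // -wg.
split=> [|i ib]; rewrite hb; last by rewrite height_schroder_ge0 //; lia.
by rewrite -[RHS](height_schroder_end x); congr (height x); lia.
Qed.

Lemma card_zero_tunnels x : #|zero_tunnels x| = #|zero_rises x|.
Proof.
pose f (t : factors n) : 'I_n.*2.+1 := inord (width (alpha t)).
have fE t : t \in zero_tunnels x -> f t = width (alpha t) :> nat.
  by move=> /tunnel_rises/andP[/ltnW tn _]; rewrite inordK.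
have inj : {in zero_tunnels x &, injective f}.
  move=> t t' tx tx' ff; apply: (zero_tunnels_inj tx tx').
  by rewrite -!fE // ff.
rewrite -(card_in_imset inj); apply: eq_card => k.
rewrite inE; apply/imsetP/andP => [[t tx ->]|[kn kr]].
  by apply/andP; rewrite fE //; exact: tunnel_rises.
have [t tx tk] := rise_tunnel kn kr.
by exists t => //; apply: val_inj; rewrite /= fE.
Qed.

(** * Modularity of the number of rises *)

Lemma rises_atE x k : (k < n.*2)%N ->
  rises_at x k = ~~ (0 < height x k) && (0 < height x k.+1).
Proof.
move=> kn; have := schroder_path_like x kn; rewrite /rises_at /path_like.
have := height_schroder_ge0 x kn; have := height_schroder_ge0 x (ltnW kn).
rewrite le_eqVlt => /orP[/eqP <-|]; last by case: ltgtP.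
by rewrite ltxx eqxx /=; case: odd => /= h1 h2; apply/eqP/idP; lia.
Qed.

(** Vertices have even coordinate sum: a step down onto the axis starts at ordinate 1, hence at odd
    [k], and a step up from the axis starts at even [k]. *)
Lemma height_gt0_step x k : (k < n.*2)%N ->
  if odd k then 0 < height x k.+1 -> 0 < height x k
  else 0 < height x k -> 0 < height x k.+1.
Proof.
move=> kn; have := schroder_path_like x kn; rewrite /path_like.
have := height_schroder_ge0 x kn; have := height_schroder_ge0 x (ltnW kn).
move: (height x k) (height x k.+1) => a b.
case: (boolP (odd k)) => ok; case: (boolP (odd (k + `|a|))) => oka; lia.
Qed.

(** For odd [k] there is no rise. For even [k] the indicator of a rise is that of positivity at
    [k + 1] minus that at [k], and both are modular under max and min. *)
Lemma rises_at_modular x y k : (k < n.*2)%N ->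
  (rises_at (x `|` y)%O k + rises_at (x `&` y)%O k =
   rises_at x k + rises_at y k)%N.
Proof.
move=> kn; have kn' := ltnW kn; rewrite !rises_atE //.
rewrite -[(x `|` y)%O]/(schroder_join x y) -[(x `&` y)%O]/(schroder_meet x y).
rewrite !height_join // !height_meet // !lt_max !lt_min.
have := height_gt0_step x kn; have := height_gt0_step y kn.
case: odd; case: (0 < height x k); case: (0 < height x k.+1);
  case: (0 < height y k); case: (0 < height y k.+1) => //= hy hx;
  by [have := hx isT | have := hy isT].
Qed.

Lemma card_zero_rises_modular x y :
  (#|zero_rises (x `|` y)%O| + #|zero_rises (x `&` y)%O| =
   #|zero_rises x| + #|zero_rises y|)%N.
Proof.
have cardE z : #|zero_rises z| = (\sum_(k < n.*2.+1 | (k < n.*2)%N) rises_at z k)%N.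
  rewrite -sum1_card -big_mkcondr /=.
  by apply: eq_bigl => k; rewrite inE.
by rewrite !cardE -!big_split; apply: eq_bigr => k; exact: rises_at_modular.
Qed.

(** * Rises of the bottom and of join-irreducible paths *)

Lemma height_bot k : (k <= n.*2)%N -> height (\bot%O : schroder n) k = 0.
Proof.
move=> kn; rewrite -[\bot%O]/(schroder_bot n) schroder_botE.
by elim: (X in nseq X) k {kn} => [|m IHm] k //=; rewrite IHm addr0 if_same.
Qed.

Lemma zero_rises_bot : zero_rises \bot%O = set0.
Proof.
apply/setP => k; rewrite !inE /rises_at; apply/negP => /and3P[kn _].
by rewrite height_bot.
Qed.

Lemma no_rise_bot x : zero_rises x = set0 -> x = \bot%O.
Proof.
move=> x0; apply: schroder_eqP => k kn; rewrite height_bot //.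
elim: k kn => [|k IHk] kn; first by rewrite height0.
have hk := IHk (ltnW kn).
have kE : (inord k : 'I_n.*2.+1) = k :> nat by rewrite inordK // ltnW.
have /setP/(_ (inord k)) := x0; rewrite !inE kE kn /rises_at hk eqxx /= => /eqP.
have := schroder_path_like x kn; have := height_schroder_ge0 x kn.
rewrite /path_like hk; case: ifP; lia.
Qed.

(** Cut [x] at [k2], where it meets the axis: [u] keeps the part before and [v] the part after. Then
    [u] lacks the rise at [k2] and [v] the one at [k1], so neither equals [x]. *)
Lemma two_rises_reducible x k1 k2 : (k1 < k2)%N -> (k2 < n.*2)%N ->
  rises_at x k1 -> rises_at x k2 -> ~ join_irreducible x.
Proof.
move=> k12 k2n /andP[_ /eqP x1] /andP[/eqP x2 /eqP x2S] [_ xirr].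
(* The ordinate changes right after [k2], so [x] has a vertex there; this lets both cut functions be
   [path_like] at [k2]. *)
have k2e : ~~ odd k2.
  have := schroder_path_like x k2n; rewrite /path_like x2 x2S addn0.
  by case: odd.
have [||||u uE] := @schroder_ex n (fun k => if (k <= k2)%N then height x k else 0).
- by rewrite height0.
- by rewrite leqNgt k2n.
- by move=> k kn; case: ifP => // _; exact: height_schroder_ge0.
- move=> k kn; have := schroder_path_like x kn; rewrite /path_like.
  have [kk2|kk2|->] := ltngtP k k2; rewrite ?x2 ?addn0 ?(negbTE k2e) //.
  by move=> _; case: odd; rewrite ?subrr.
have [||||v vE] := @schroder_ex n (fun k => if (k <= k2)%N then 0 else height x k).
- by [].
- by rewrite leqNgt k2n height_schroder_end.
- by move=> k kn; case: ifP => // _; exact: height_schroder_ge0.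
- move=> k kn; have := schroder_path_like x kn; rewrite /path_like.
  have [kk2|kk2|->] := ltngtP k k2; rewrite ?x2 ?addn0 ?(negbTE k2e) //.
  by move=> _; case: odd; rewrite ?subrr.
have xuv : x = (u `|` v)%O.
  apply: schroder_eqP => k kn; rewrite -[(_ `|` _)%O]/(schroder_join u v).
  have := height_schroder_ge0 x kn.
  by rewrite height_join // uE // vE //; case: ifP; lia.
have [xu|xv] := xirr _ _ xuv.
  by have := uE k2.+1 k2n; rewrite -xu x2S ltnn.
by have := vE k1.+1 (leq_trans k12 (ltnW k2n)); rewrite -xv x1 k12.
Qed.

Lemma card_zero_rises_join_irreducible x :
  join_irreducible x -> #|zero_rises x| = 1%N.
Proof.
move=> xirr; apply/eqP; rewrite eqn_leq card_gt0 andbC.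
apply/andP; split; first by apply/eqP => /no_rise_bot; case: xirr.
apply/card_le1_eqP => k1 k2; rewrite !inE.
move=> /andP[k1n r1] /andP[k2n r2]; apply: val_inj => /=.
case: (ltngtP k1 k2) => // lt12; exfalso.
  exact: (two_rises_reducible lt12 k2n r1 r2 xirr).
exact: (two_rises_reducible lt12 k1n r2 r1 xirr).
Qed.

End Rises.

Theorem theorem5p4 (R : realType) (n : nat) (x : schroder n) :
  euler_characteristic R x = (#|zero_tunnels x|%:R)%R.
Proof.
rewrite card_zero_tunnels; apply/esym.
apply: (euler_characteristic_unique (nu := fun y => #|zero_rises y|%:R)).
  split=> [|y z]; first by rewrite zero_rises_bot cards0.
  by rewrite -!natrD card_zero_rises_modular.
by move=> j /card_zero_rises_join_irreducible ->.
Qed.
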